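(* Suppose $\mathcal{R}$ is a nontrivial Urysohn monoid. If $\mathrm{heq}(\mathcal{R})\neq\emptyset$, then $\mathrm{Th}(\mathcal{U}_{\mathcal{R}})$ does not have elimination of hyperimaginaries.
   Context: A distance monoid is a structure $\mathcal{R}=(R,\oplus,\leq,0)$ such that $(R,\oplus,0)$ is a commutative monoid and $\leq$ is a total, translation-invariant order on $R$ with least element $0$; it is nontrivial if $R\neq\{0\}$. An $\mathcal{R}$-metric space is a set $A$ with a symmetric function $d:A\times A\to R$ such that $d(x,y)=0$ iff $x=y$, and $d(x,z)\leq d(x,y)\oplus d(y,z)$ for all $x,y,z\in A$. For countable $\mathcal{R}$, the $\mathcal{R}$-Urysohn space $\mathcal{U}_{\mathcal{R}}$ is the unique (up to isometry) countable $\mathcal{R}$-metric space that is ultrahomogeneous and contains an isometric copy of every finite $\mathcal{R}$-metric space. It is viewed as a structure in the relational language $\mathcal{L}_R=\{d(x,y)\leq r:r\in R\}$ of binary relations, and $\mathrm{Th}(\mathcal{U}_{\mathcal{R}})$ is its complete $\mathcal{L}_R$-theory. A Urysohn monoid is a countable distance monoid $\mathcal{R}$ such that $\mathrm{Th}(\mathcal{U}_{\mathcal{R}})$ has quantifier elimination in $\mathcal{L}_R$. The extension $\mathcal{R}^*=(R^*,\oplus,\leq,0)$: $R^*$ is the set of quantifier-free $2$-types consistent with $\mathrm{Th}(\mathcal{U}_{\mathcal{R}})$; identifying a type $p(x,y)$ with $\{r\in R: (d(x,y)\leq r)\in p\}$, $R^*$ is the set of upward closed subsets of $R$ (excluding $\emptyset$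 exactly when $R$ has a maximal element), ordered by reverse inclusion, with $r\in R$ identified with $\{x\in R:x\geq r\}$. Then $(R^*,\leq)$ is a Dedekind complete linear order with a maximal element. Addition is extended by $\alpha\oplus\beta=\inf\{r\oplus s:r,s\in R,\ \alpha\leq r,\ \beta\leq s\}$, making $\mathcal{R}^*$ a distance monoid extending $\mathcal{R}$. Convention: infima and suprema are taken in $R^*$, and $\inf\emptyset=\sup R^*$. For a distance monoid $\mathcal{S}=(S,\oplus,\leq,0)$, let $\mathrm{eq}(\mathcal{S})=\{s\in S:s\oplus s=s\}$. Define $\mathrm{heq}(\mathcal{R})=\{\alpha\in\mathrm{eq}(\mathcal{R}^* ):\alpha<\inf\{r\in\mathrm{eq}(\mathcal{R}):\alpha\leq r\}\}$. For a complete theory $T$ with monster model $\mathbb{M}$, a hyperimaginary ($e\in\mathbb{M}^{\mathrm{heq}}$) is a class $\bar a_E$ of a (small, possibly infinite) tuple $\bar a$ modulo an equivalence relation $E$ type-definable over $\emptyset$. $T$ has elimination of hyperimaginaries if, for any $e\in\mathbb{M}^{\mathrm{heq}}$, there is a small set $A\subset\mathbb{M}^{\mathrm{eq}}$ such that $\mathrm{Aut}(\mathbb{M}/e)=\mathrm{Aut}(\mathbb{M}/A)$. *)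

(* Defs.v *)
From mathcomp Require Import all_boot all_order.
From mathcomp Require Import all_classical.

Set Implicit Arguments.
Unset Strict Implicit.
Unset Printing Implicit Defensive.

Import Order.TTheory.
Local Open Scope classical_set_scope.
Local Open Scope card_scope.
Local Open Scope order_scope.

Reserved Notation "x ⊕ y" (at level 50, left associativity).

(* Translation invariance is weak, since the operation need not be
   cancellative. *)
Record distMonoid (d : Order.disp_t) := DistMonoid {
  dm_sort :> orderType d;
  dm_add : dm_sort -> dm_sort -> dm_sort;
  dm_zero : dm_sort;
  dm_addA : associative dm_add;
  dm_addC : commutative dm_add;
  dm_add0 : left_id dm_zero dm_add;
  dm_ge0 : forall r : dm_sort, dm_zero <= r;
  dm_leD2r : forall t r s : dm_sort, r <= s -> dm_add r t <= dm_add s t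
}.

Notation "x ⊕ y" := (dm_add x y).
Arguments dm_zero {d R} : rename.

Definition idempotents (S : Type) (op : S -> S -> S) : set S :=
  [set s | op s s = s].

Record metricSpace (d : Order.disp_t) (R : distMonoid d) := MetricSpace {
  ms_carrier :> Type;
  dist : ms_carrier -> ms_carrier -> R;
  dist_sym : forall x y, dist x y = dist y x;
  dist_eq0 : forall x y, dist x y = dm_zero <-> x = y;
  dist_triangle : forall x y z, dist x z <= dist x y ⊕ dist y z
}.

Definition isometry_on (d : Order.disp_t) (R : distMonoid d) (A B : metricSpace R)
    (D : set A) (f : A -> B) : Prop :=
  forall x y, D x -> D y -> dist (f x) (f y) = dist x y.

Definition ultrahomogeneous (d : Order.disp_t) (R : distMonoid d) (U : metricSpace R) : Prop :=
  forall (D : set U) (f : U -> U), finite_set D -> isometry_on D f ->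
  exists g : U -> U,
    [/\ bijective g, isometry_on setT g & forall x, D x -> g x = f x].

Definition urysohn_space (d : Order.disp_t) (R : distMonoid d) (U : metricSpace R) : Prop :=
  [/\ countable [set: U],
      ultrahomogeneous U &
      forall A : metricSpace R, finite_set [set: A] ->
        exists f : A -> U, isometry_on setT f].

(* First-order formulas, with equality, over a language [L] of binary relation
   symbols. [formula L V] is the type of formulas whose free variables are in [V];
   under a quantifier, [None] is the bound variable. *)
Inductive formula (L V : Type) : Type :=
| Bot : formula L V
| Eq : V -> V -> formula L V
| Rel : L -> V -> V -> formula L V
| Imp : formula L V -> formula L V -> formula L V
| All : formula L (option V) -> formula L V.

Fixpoint quantifier_free (L V : Type) (phi : formula L V) : Prop :=
  match phi with
  | Imp phi1 phi2 => quantifier_free phi1 /\ quantifier_free phi2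
  | All _ => False
  | _ => True
  end.

Record structure (L : Type) := Structure {
  carrier :> Type;
  interp : L -> carrier -> carrier -> Prop
}.

Fixpoint sat (L : Type) (M : structure L) (V : Type) (v : V -> M)
    (phi : formula L V) {struct phi} : Prop :=
  match phi with
  | Bot => False
  | Eq i j => v i = v j
  | Rel l i j => interp l (v i) (v j)
  | Imp phi1 phi2 => sat v phi1 -> sat v phi2
  | All phi1 => forall x : M, sat (oapp v x) phi1
  end.

Definition theory (L : Type) := set (formula L void).

Definition Th (L : Type) (M : structure L) : theory L :=
  [set phi | sat (of_void M) phi].

Definition models (L : Type) (M : structure L) (T : theory L) : Prop :=
  T `<=` Th M.

Definition quantifier_elimination (L : Type) (T : theory L) : Prop :=
  forall (n : nat) (phi : formula L 'I_n), exists psi : formula L 'I_n,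
    quantifier_free psi /\
    forall M : structure L, models M T ->
      forall v : 'I_n -> M, sat v phi <-> sat v psi.

Definition automorphism (L : Type) (M : structure L) (s : M -> M) : Prop :=
  bijective s /\
  forall (l : L) (x y : M), interp l (s x) (s y) <-> interp l x y.

(* Cardinals are represented by types: [small kappa A] means |A| < |kappa|. *)
Definition small (kappa T : Type) (A : set T) : Prop :=
  (A #<= [set: kappa]) /\ ~ ([set: kappa] #<= A).

(* Realization of 1-types over the parameters enumerated by [a]; in a formula
   over [option I], [None] is the variable and [Some i] stands for [a i]. *)
Definition saturated (kappa L : Type) (M : structure L) : Prop :=
  forall (I : Type) (a : I -> M) (p : set (formula L (option I))),
    small kappa [set: I] ->
    (forall q : set (formula L (option I)), finite_set q -> q `<=` p ->
       exists x : M, forall phi, q phi -> sat (oapp a x) phi) ->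
    exists x : M, forall phi, p phi -> sat (oapp a x) phi.

Definition strongly_homogeneous (kappa L : Type) (M : structure L) : Prop :=
  forall (I : Type) (a b : I -> M),
    small kappa [set: I] ->
    (forall phi : formula L I, sat a phi <-> sat b phi) ->
    exists s : M -> M, automorphism s /\ forall i, s (a i) = b i.

Definition monster_model (kappa L : Type) (T : theory L) (M : structure L) :
    Prop :=
  [/\ models M T,
      small kappa [set: nat] /\ small kappa [set: L],
      saturated kappa M &
      strongly_homogeneous kappa M].

Definition pair_valuation (I M : Type) (a b : I -> M) (z : I + I) : M :=
  match z with inl i => a i | inr i => b i end.

(* The relation on [I]-tuples type-defined over the empty set by [p]. *)
Definition type_rel (L : Type) (M : structure L) (I : Type)
    (p : set (formula L (I + I))) (a b : I -> M) : Prop :=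
  forall phi, p phi -> sat (pair_valuation a b) phi.

Definition is_class (X : Type) (E : X -> X -> Prop) (e : set X) : Prop :=
  exists a, e = [set b | E a b].

(* The elements of M^eq. *)
Record imaginary (L : Type) (M : structure L) := Imaginary {
  im_arity : nat;
  im_formula : formula L ('I_im_arity + 'I_im_arity);
  im_equiv : RelationClasses.Equivalence (type_rel (M := M) [set im_formula]);
  im_class : set ('I_im_arity -> M);
  im_classP : is_class (type_rel [set im_formula]) im_class
}.

Arguments im_class {L M} i _ : rename.

Definition fixes (M I : Type) (s : M -> M) (e : set (I -> M)) : Prop :=
  [set s \o b | b in e] = e.

Definition eliminates_hyperimaginaries (kappa L : Type) (M : structure L) :
    Prop :=
  forall (I : Type) (p : set (formula L (I + I))) (e : set (I -> M)),
    small kappa [set: I] ->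
    RelationClasses.Equivalence (type_rel (M := M) p) ->
    is_class (type_rel p) e ->
    exists A : set (imaginary M),
      small kappa A /\
      forall s : M -> M, automorphism s ->
        (fixes s e <-> forall c, A c -> fixes s (im_class c)).

(* The symbol indexed by [r : R] is the relation d(x, y) <= r. *)
Definition metric_structure (d : Order.disp_t) (R : distMonoid d) (U : metricSpace R) :
    structure R :=
  Structure (fun (r : R) (x y : U) => dist x y <= r : Prop).

Definition urysohn_monoid (d : Order.disp_t) (R : distMonoid d) : Prop :=
  countable [set: R] /\
  forall U : metricSpace R, urysohn_space U ->
    quantifier_elimination (Th (metric_structure U)).

Definition is_max (d : Order.disp_t) (R : distMonoid d) (m : R) : Prop := forall x, x <= m.

(* The 2-type alpha is the set of [r] such that "d(x, y) <= r" is in alpha. *)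
Record star (d : Order.disp_t) (R : distMonoid d) := Star {
  cut :> set R;
  cut_up : forall x y, cut x -> x <= y -> cut y;
  cut_neq0 : (exists m : R, is_max m) -> cut !=set0
}.

Section Star.
Variables (d : Order.disp_t) (R : distMonoid d).
Implicit Types (a b c : star R) (S : set (star R)).

Definition star_le a b : Prop := cut b `<=` cut a.
Definition star_lt a b : Prop := star_le a b /\ a <> b.

Lemma embed_up (r x y : R) : [set x | r <= x] x -> x <= y -> [set x | r <= x] y.
Proof. exact: le_trans. Qed.

Lemma embed_neq0 (r : R) : (exists m : R, is_max m) -> [set x | r <= x] !=set0.
Proof. by move=> _; exists r => /=. Qed.

Definition star_embed (r : R) : star R := Star (@embed_up r) (@embed_neq0 r).

(* A maximal element of [R], if any, is in every cut: adding it only matters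
   for the empty [S], whose infimum is thus the top element of R^*. *)
Definition inf_cut S : set R :=
  [set x | (exists2 a, S a & cut a x) \/ is_max x].

Lemma inf_cut_up S (x y : R) : inf_cut S x -> x <= y -> inf_cut S y.
Proof.
case=> [[a Sa ax] xy|mx xy]; first by left; exists a => //; apply: cut_up xy.
by right=> z; apply: le_trans xy.
Qed.

Lemma inf_cut_neq0 S : (exists m : R, is_max m) -> inf_cut S !=set0.
Proof. by case=> m mm; exists m; right. Qed.

Definition star_inf S : star R := Star (@inf_cut_up S) (@inf_cut_neq0 S).

Lemma star_inf_lb S a : S a -> star_le (star_inf S) a.
Proof. by move=> Sa x ax; left; exists a. Qed.

Lemma star_inf_glb S b : (forall a, S a -> star_le b a) ->
  star_le b (star_inf S).
Proof.
move=> lb x [[a Sa ax]|mx]; first exact: lb ax.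
by have [|y byy] := @cut_neq0 _ _ b; [exists x|exact: cut_up byy (mx y)].
Qed.

Definition star_add a b : star R :=
  star_inf [set c | exists r s : R,
    [/\ star_le a (star_embed r), star_le b (star_embed s) &
        c = star_embed (r ⊕ s)]].

Definition heq : set (star R) :=
  [set a | idempotents star_add a /\
    star_lt a (star_inf [set star_embed r | r in
      [set r : R | idempotents (@dm_add d R) r /\ star_le a (star_embed r)]])].

End Star.

Arguments heq {d} R _.

(* Main.v *)
Require Import Defs.
From mathcomp Require Import all_boot all_order.
From mathcomp Require Import all_classical.

(** Let [alpha] be a cut in [heq R]. Since [alpha] is idempotent,
    d(x, y) <= alpha is a type-definable equivalence relation on the points of
    the monster model [M]; the class [e] of a point [a] is the hyperimaginary
    that no set of imaginaries can replace.

    Suppose that a set [A] of imaginaries had the same stabilizer as [e]. Every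
    [c] in [A] is fixed by the automorphisms that fix [a], so by compactness [c]
    is the value at [a] of a definable function on points, and comparing the
    values of this function at two points gives a definable preorder [F] such
    that [F a (g a)] holds exactly when the automorphism [g] fixes [c]
    ([definable_preorder_of_imaginary]). By quantifier elimination [F] only
    looks at how d(x, y) compares with finitely many elements of [R]. In the
    Urysohn space every isosceles triangle allowed by the triangle inequality
    occurs, and this forces [F] to be either trivial or a relation
    d(x, y) <= m with [m] an idempotent of [R] ([preorder_ball]); completeness
    of the theory carries this dichotomy over to [M] ([model_preorder_ball]).

    As the stabilizer of [e] fixes [c], [F] contains d(x, y) <= alpha, and
    saturation then gives [alpha <= m]. Now [alpha] lies strictly below the
    infimum of the idempotents of [R] above it, so there is [s >= alpha] in [R]
    smaller than all these idempotents ([heq_gap]), and by saturation a point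
    [b] whose distance to [a] is at most each of these idempotents but not at
    most [s] ([model_realize_gap]). This one point [b] satisfies [F a b] for all
    [c] in [A] at once. All points have the same type, so some automorphism
    sends [a] to [b]: it fixes every element of [A], but it moves [e]. *)

Set Implicit Arguments.
Unset Strict Implicit.
Unset Printing Implicit Defensive.

Import Order.TTheory.
Local Open Scope classical_set_scope.
Local Open Scope card_scope.
Local Open Scope order_scope.

(** * Definable relations *)

Fixpoint rename (L V W : Type) (f : V -> W) (phi : formula L V) {struct phi} :
    formula L W :=
  match phi with
  | Bot => @Bot L W
  | Eq i j => Eq L (f i) (f j)
  | Rel l i j => Rel l (f i) (f j)
  | Imp phi1 phi2 => Imp (rename f phi1) (rename f phi2)
  | All phi1 => All (rename (omap f) phi1)
  end.

Lemma sat_rename (L : Type) (M : structure L) (V W : Type) (f : V -> W)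
    (phi : formula L V) (v : W -> M) :
  sat v (rename f phi) <-> sat (v \o f) phi.
Proof.
elim: phi W f v => {V} [V|V i j|V l i j|V p IHp q IHq|V p IHp] W f v //=.
  by rewrite IHp IHq.
split=> H x; have := H x; rewrite IHp;
  by congr sat; apply/funext; case.
Qed.

(** Relations are handled through this semantic notion, so that formulas need
    not be written down; only the transfer between models needs syntax. *)
Definition definable (L : Type) (M : structure L) (V : Type)
    (P : (V -> M) -> Prop) : Prop :=
  exists phi : formula L V, forall v, sat v phi <-> P v.

Section Definable.
Variables (L : Type) (M : structure L).

Lemma definable_ext (V : Type) (P Q : (V -> M) -> Prop) :
  (forall v, P v <-> Q v) -> definable P -> definable Q.
Proof. by move=> PQ [phi H]; exists phi => v; rewrite H PQ. Qed.

Lemma definable_sat (V : Type) (phi : formula L V) :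
  definable (fun v : V -> M => sat v phi).
Proof. by exists phi. Qed.

Lemma definable_comp (V W : Type) (f : V -> W) (P : (V -> M) -> Prop) :
  definable P -> definable (fun w : W -> M => P (w \o f)).
Proof. by case=> phi H; exists (rename f phi) => v; rewrite sat_rename H. Qed.

Lemma definable_imp (V : Type) (P Q : (V -> M) -> Prop) :
  definable P -> definable Q -> definable (fun v => P v -> Q v).
Proof. by case=> p Hp [q Hq]; exists (Imp p q) => v /=; rewrite Hp Hq. Qed.

Lemma definable_not (V : Type) (P : (V -> M) -> Prop) :
  definable P -> definable (fun v => ~ P v).
Proof. by case=> p Hp; exists (Imp p (@Bot L V)) => v /=; rewrite Hp. Qed.

Lemma definable_and (V : Type) (P Q : (V -> M) -> Prop) :
  definable P -> definable Q -> definable (fun v => P v /\ Q v).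
Proof.
move=> dP dQ; have := definable_not (definable_imp dP (definable_not dQ)).
by apply: definable_ext => v; rewrite not_implyP notK.
Qed.

Lemma definable_all (V : Type) (P : (option V -> M) -> Prop) :
  definable P -> definable (fun v : V -> M => forall x, P (oapp v x)).
Proof. by case=> p Hp; exists (All p) => v /=; split=> H x; apply/Hp. Qed.

Lemma definable_ex (V : Type) (P : (option V -> M) -> Prop) :
  definable P -> definable (fun v : V -> M => exists x, P (oapp v x)).
Proof.
move=> /definable_not/definable_all/definable_not; apply: definable_ext => v.
by rewrite -existsNP; split=> -[x]; [move=> /contrapT|move=> ?]; exists x.
Qed.

Definition sum_valuation (I J : Type) (a : I -> M) (b : J -> M) (z : I + J) : M :=
  match z with inl i => a i | inr j => b j end.

Definition split_first (I : Type) (n : nat) (z : I + 'I_n.+1) :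
    option (I + 'I_n) :=
  match z with inl i => Some (inl i) | inr k => omap inr (unlift ord0 k) end.

Definition cons_tuple (n : nat) (x : M) (z : 'I_n -> M) (k : 'I_n.+1) : M :=
  oapp z x (unlift ord0 k).

Lemma cons_tuple_eta (n : nat) (z : 'I_n.+1 -> M) :
  z = cons_tuple (z ord0) (z \o lift ord0).
Proof. by apply/funext => k; rewrite /cons_tuple; case: unliftP => [j ->|->]. Qed.

Lemma sum_valuation_cons (I : Type) (n : nat) (a : I -> M) (x : M) (z : 'I_n -> M) :
  sum_valuation a (cons_tuple x z) = oapp (sum_valuation a z) x \o @split_first I n.
Proof.
by apply/funext => -[i//|k] /=; rewrite /cons_tuple; case: unlift.
Qed.

Lemma empty_tuple (z w : 'I_0 -> M) : z = w.
Proof. by apply/funext => -[]. Qed.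

(** Quantification over a finite tuple removes one variable at a time; this is
    the reason for [split_first], which isolates the first entry. *)
Lemma definable_all_tuple (n : nat) (V : Type) (P : (V + 'I_n -> M) -> Prop) :
  definable P ->
  definable (fun v : V -> M => forall z, P (sum_valuation v z)).
Proof.
elim: n P => [|n IHn] P dP.
  pose drop (z : V + 'I_0) : V :=
    match z with inl i => i | inr k => False_rect V (notF (ltn_ord k)) end.
  apply: definable_ext (definable_comp drop dP) => v.
  have E z : sum_valuation v z = v \o drop.
    by apply/funext => -[//|k]; case: (notF (ltn_ord k)).
  split=> [H z|H]; first by rewrite E.
  by rewrite -(E (fun k => False_rect M (notF (ltn_ord k)))).
have /definable_all/IHn := definable_comp (@split_first V n) dP.
apply: definable_ext => v; split=> H z; last first.
  by move=> x; rewrite -sum_valuation_cons.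
by rewrite (cons_tuple_eta z) sum_valuation_cons; apply: H.
Qed.

End Definable.

(** * Automorphisms *)

Section Automorphisms.
Variables (L : Type) (M : structure L).

Lemma sat_automorphism (s : M -> M) (V : Type) (v : V -> M) (phi : formula L V) :
  automorphism s -> sat (s \o v) phi <-> sat v phi.
Proof.
case=> bs rs; elim: phi v => {V} [V|V i j|V l i j|V p IHp q IHq|V p IHp] v //=.
- by split=> [/(bij_inj bs)//|->].
- by rewrite IHp IHq.
have E x : oapp (s \o v) (s x) = s \o oapp v x by apply/funext; case.
split=> H x; first by apply/IHp; rewrite -E.
by case: bs => t tK sK; rewrite -(sK x) E; apply/IHp.
Qed.

Lemma definable_automorphism (s : M -> M) (V : Type) (P : (V -> M) -> Prop)
    (v : V -> M) :
  automorphism s -> definable P -> P (s \o v) <-> P v.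
Proof. by move=> As [phi H]; rewrite -!H; apply: sat_automorphism. Qed.

Lemma type_rel_automorphism (s : M -> M) (I : Type) (p : set (formula L (I + I)))
    (a b : I -> M) :
  automorphism s -> type_rel p (s \o a) (s \o b) <-> type_rel p a b.
Proof.
have E : pair_valuation (s \o a) (s \o b) = s \o pair_valuation a b.
  by apply/funext; case.
move=> As; split=> H phi /H; rewrite E => /(@sat_automorphism s);
  by [apply|apply: sat_automorphism].
Qed.

(** Automorphisms permute the classes of a type-definable equivalence relation,
    so the image of a class is known from the image of one representative. *)
Lemma fixesP (I : Type) (p : set (formula L (I + I))) (a : I -> M) (s : M -> M) :
  RelationClasses.Equivalence (type_rel (M := M) p) -> automorphism s ->
  fixes s [set b | type_rel p a b] <-> type_rel p a (s \o a).
Proof.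
move=> [Er Es Et] As; split=> [fx|H].
  suff : [set b | type_rel p a b] (s \o a) by [].
  by rewrite -[X in X _]fx; exists a => //; apply: Er.
apply/seteqP; split=> [b [b' ab' <-]|b ab].
  by apply: Et H _; apply/type_rel_automorphism.
case: (As) => -[t sK tK] _.
have Eb : s \o (t \o b) = b by apply/funext => i /=; rewrite tK.
exists (t \o b) => //=; apply/(type_rel_automorphism _ _ _ As).
by rewrite Eb; apply: Et ab; apply: Es.
Qed.

End Automorphisms.

(** * Saturation *)

Lemma small_countable (kappa : Type) (I : countType) :
  small kappa [set: nat] -> small kappa [set: I].
Proof.
case=> nk kn; have cI : [set: I] #<= [set: nat] by apply: countableP.
split; first exact: card_le_trans nk.
by move=> kI; apply: kn; apply: card_le_trans kI cI.
Qed.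

Section Saturation.
Variables (kappa L : Type) (M : structure L).
Hypotheses (hN : small kappa [set: nat]) (hsat : saturated kappa M).

(** Directed families replace finitely satisfiable types: directedness passes to
    projections along a variable, which is what the induction in
    [saturated_tuple] uses. *)
Definition directed (V J : Type) (X : J -> (V -> M) -> Prop) : Prop :=
  forall i j, exists k, forall v, X k v -> X i v /\ X j v.

Lemma saturated_directed (I : countType) (a : I -> M) (J : Type) (j0 : J)
    (X : J -> (option I -> M) -> Prop) :
  (forall j, definable (X j)) -> directed X ->
  (forall j, exists x, X j (oapp a x)) ->
  exists x, forall j, X j (oapp a x).
Proof.
move=> dX dirX fX.
pose p := [set phi : formula L (option I) | exists j, forall v, sat v phi <-> X j v].
have [|x Hx] := hsat (a := a) (p := p) (small_countable _ hN); last first.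
  exists x => j; have [phi Hphi] := dX j.
  by apply/Hphi/Hx; exists j.
move=> q /(@finite_seqP {classic formula L (option I)})[s ->] sp.
suff [j Hj] : exists j, forall v, X j v ->
    forall phi : {classic formula L (option I)}, phi \in s -> sat v phi.
  by have [x Xx] := fX j; exists x => phi; apply: Hj.
elim: s sp => [|phi s IHs] sp; first by exists j0.
have [|i Hi] := IHs; first by move=> psi /= ps; apply: sp => /=; rewrite inE ps orbT.
have [|j Hj] := sp phi; first by rewrite /= mem_head.
have [k Hk] := dirX i j; exists k => v /Hk[Xi Xj] psi.
by rewrite inE => /predU1P[->|/(Hi _ Xi)//]; apply/Hj.
Qed.

(** Saturation speaks of a single variable. The last [n] entries are found first,
    as a realization of the projected family, and then serve as parameters for
    the remaining entry. *)
Lemma saturated_tuple (n : nat) (I : countType) (a : I -> M) (J : Type) (j0 : J)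
    (X : J -> (I + 'I_n -> M) -> Prop) :
  (forall j, definable (X j)) -> directed X ->
  (forall j, exists z, X j (sum_valuation a z)) ->
  exists z, forall j, X j (sum_valuation a z).
Proof.
elim: n X => [|n IHn] X dX dirX fX.
  by have [z _] := fX j0; exists z => j; have [w] := fX j; rewrite (empty_tuple w z).
pose Y j (v : option (I + 'I_n) -> M) := X j (v \o @split_first I n).
have dY j : definable (Y j) by apply: definable_comp.
have dirY : directed Y by move=> i j; have [k Hk] := dirX i j; exists k => v; apply: Hk.
have [|||z Hz] := IHn (fun j v => exists x, Y j (oapp v x)).
- by move=> j; apply: definable_ex.
- move=> i j; have [k Hk] := dirY i j; exists k => v [x /Hk[Yi Yj]].
  by split; exists x.
- move=> j; have [z] := fX j; rewrite (cons_tuple_eta z) sum_valuation_cons.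
  by move=> H; exists (z \o lift ord0), (z ord0).
have [x Hx] := saturated_directed j0 dY dirY Hz.
by exists (cons_tuple x z) => j; rewrite sum_valuation_cons; apply: Hx.
Qed.

End Saturation.

(** * Imaginaries fixed by the stabilizer of a point *)

Definition pair_fun (M : Type) (x y : M) (i : 'I_2) : M := if i == ord0 then x else y.

Definition preorder (M : Type) (F : M -> M -> Prop) : Prop :=
  (forall x, F x x) /\ (forall x y z, F x y -> F y z -> F x z).

(** The usual argument that an element invariant under the automorphisms fixing
    [a] is definable over [a]. If [c] is the [Phi]-class of the tuple [cb],
    compactness and homogeneity give a definable [T] satisfied by [(a, cb)] such
    that [T(a, z)] puts [z] in [c]. The class of the tuples [z] with [T(x, z)] is
    then a definable function of [x] with value [c] at [a], and [F] compares the
    values of this function at two points. *)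
Lemma definable_preorder_of_imaginary (kappa L : Type) (M : structure L)
    (hN : small kappa [set: nat]) (hsat : saturated kappa M)
    (hhom : strongly_homogeneous kappa M)
    (htrans : forall x y : M, exists s : M -> M, automorphism s /\ s x = y)
    (a : M) (c : imaginary M) :
  (forall s : M -> M, automorphism s -> s a = a -> fixes s (im_class c)) ->
  exists F : M -> M -> Prop,
    [/\ preorder F,
        definable (fun v : 'I_2 -> M => F (v ord0) (v (lift ord0 ord0))) &
        forall s : M -> M, automorphism s ->
          F a (s a) <-> fixes s (im_class c)].
Proof.
case: c => n phi Eq cl /= [cb ->] fixa; case: (Eq) => Er Es Et.
set Phi := type_rel [set phi] in Er Es Et.
have PhiA s x y : automorphism s -> Phi (s \o x) (s \o y) <-> Phi x y.
  by move=> As; apply: type_rel_automorphism.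
have PhiD : definable (fun v : 'I_n + 'I_n -> M => Phi (v \o inl) (v \o inr)).
  apply: definable_ext (definable_sat M phi) => v.
  have <- : pair_valuation (v \o inl) (v \o inr) = v by apply/funext; case.
  by split=> [H _ -> //|/(_ phi)]; apply.
have [T [dT Tac TPhi]] : exists T : (option 'I_n -> M) -> Prop,
    [/\ definable T, T (oapp cb a) & forall z, T (oapp z a) -> Phi cb z].
  (* Otherwise the type of [cb] over [a] has a realization outside [c]; it is
     the image of [cb] under an automorphism fixing [a], hence [c]. *)
  apply: contrapT => noT.
  pose J := {T : (option 'I_n -> M) -> Prop | definable T /\ T (oapp cb a)}.
  have mkJ T : definable T -> T (oapp cb a) -> exists j : J, sval j = T.
    by move=> dT Tc; exists (exist _ T (conj dT Tc)).
  pose rd (z : option 'I_n) : option 'I_n + 'I_n :=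
    if z is Some k then inr k else inl None.
  pose X (j : J) (v : option 'I_n + 'I_n -> M) :=
    sval j (v \o rd) /\ ~ Phi (v \o inl \o Some) (v \o inr).
  have rdE z : sum_valuation (oapp cb a) z \o rd = oapp z a by apply/funext; case.
  have [j0 _] : exists j : J, sval j = fun=> True.
    apply: mkJ => //.
    by exists (Imp (@Bot L _) (@Bot L _)) => v /=.
  have [||| z Hz] := saturated_tuple hN hsat (a := oapp cb a) j0 (X := X).
  - move=> j; apply: definable_and.
      by apply: definable_comp; have [] := svalP j.
    apply: definable_not.
    pose g (z : 'I_n + 'I_n) : option 'I_n + 'I_n :=
      match z with inl k => inl (Some k) | inr k => inr k end.
    exact: (definable_comp g PhiD).
  - move=> i j; have [k Ek] := mkJ (fun v => sval i v /\ sval j v)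
      (definable_and (svalP i).1 (svalP j).1) (conj (svalP i).2 (svalP j).2).
    by exists k => v; rewrite /X Ek; tauto.
  - move=> j; apply: contrapT => H; apply: noT; exists (sval j).
    have [dj cj] := svalP j; split=> // z Tz; apply: contrapT => nP.
    by apply: H; exists z; split; rewrite ?rdE.
  have [s [As sE]] : exists s : M -> M, automorphism s /\
      forall i, s (oapp cb a i) = oapp z a i.
    apply: hhom; first exact: small_countable.
    (* A type is complete, so one inclusion of types is enough. *)
    have H psi : sat (oapp cb a) psi -> sat (oapp z a) psi.
      move=> H; have [j Ej] := mkJ _ (definable_sat M psi) H.
      by have [] := Hz j; rewrite Ej rdE.
    move=> psi; split; first exact: H.
    by apply: contraPP => /(H (Imp psi (@Bot L _))).
  have [_] := Hz j0; apply.
  have -> : sum_valuation (oapp cb a) z \o inr = s \o cb.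
    by apply/funext => k; rewrite /= (sE (Some k)).
  by apply/(fixesP _ Eq As)/fixa => //; apply: (sE None).
pose F x y := forall z w, T (oapp z x) -> T (oapp w y) -> Phi z w.
have TA s z x : automorphism s -> T (oapp (s \o z) (s x)) <-> T (oapp z x).
  move=> As; have -> : oapp (s \o z) (s x) = s \o oapp z x by apply/funext; case.
  exact: definable_automorphism.
exists F; split.
- split=> [x z w Tz Tw|x y z Fxy Fyz u w Tu Tw].
    have [s [As sx]] := htrans x a.
    apply/(PhiA s) => //; apply: Et (Es _ _ _) _; apply: TPhi;
      by rewrite -sx TA.
  have [s [As sa]] := htrans a y.
  have Ty : T (oapp (s \o cb) y) by rewrite -sa TA.
  by apply: Et (Fxy _ _ Tu Ty) (Fyz _ _ Ty Tw).
- have := @definable_all_tuple L M n _ _ (@definable_all_tuple L M n _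
    (fun v : ('I_2 + 'I_n) + 'I_n -> M =>
      T (oapp (v \o inl \o inr) (v (inl (inl ord0)))) ->
      T (oapp (v \o inr) (v (inl (inl (lift ord0 ord0))))) ->
      Phi (v \o inl \o inr) (v \o inr)) _).
  apply.
  apply: definable_imp; last apply: definable_imp.
  + pose g (z : option 'I_n) : 'I_2 + 'I_n + 'I_n :=
      if z is Some k then inl (inr k) else inl (inl ord0).
    apply: definable_ext (definable_comp g dT) => v.
    by have -> : v \o g = oapp (v \o inl \o inr) (v (inl (inl ord0)))
      by apply/funext; case.
  + pose g (z : option 'I_n) : 'I_2 + 'I_n + 'I_n :=
      if z is Some k then inr k else inl (inl (lift ord0 ord0)).
    apply: definable_ext (definable_comp g dT) => v.
    by have -> : v \o g = oapp (v \o inr) (v (inl (inl (lift ord0 ord0))))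
      by apply/funext; case.
  + pose g (z : 'I_n + 'I_n) : 'I_2 + 'I_n + 'I_n :=
      match z with inl k => inl (inr k) | inr k => inr k end.
    exact: (definable_comp g PhiD).
- move=> s As; rewrite (fixesP _ Eq As); split=> [|H].
    by apply=> //; apply/TA.
  move=> z w Tz Tw; case: (As) => -[t sK tK] _.
  have Ew : w = s \o (t \o w) by apply/funext => k /=; rewrite tK.
  apply: Et (Es _ _ (TPhi _ Tz)) (Et _ _ _ H _).
  by rewrite Ew; apply/PhiA => //; apply: TPhi; rewrite -(TA s) // -Ew.
Qed.

(** * Quantifier-free formulas *)

Fixpoint symbols (L V : Type) (phi : formula L V) {struct phi} : seq L :=
  match phi with
  | Rel l _ _ => [:: l]
  | Imp phi1 phi2 => symbols phi1 ++ symbols phi2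
  | All phi1 => symbols phi1
  | _ => [::]
  end.

(** The truth of a quantifier-free formula depends on the finitely many symbols
    that occur in it; this is what makes quantifier elimination a finiteness
    statement about distances. *)
Lemma sat_agree (L : eqType) (M N : structure L) (V : Type)
    (v : V -> M) (w : V -> N) (phi : formula L V) :
  quantifier_free phi ->
  (forall i j, v i = v j <-> w i = w j) ->
  (forall l, l \in symbols phi -> forall i j,
     interp l (v i) (v j) <-> interp l (w i) (w j)) ->
  sat v phi <-> sat w phi.
Proof.
elim: phi v w => {V} [V|V i j|V l i j|V p IHp q IHq|V p IHp] v w //= qf E H.
- by apply: H; rewrite mem_head.
- case: qf => qfp qfq; rewrite (IHp v w) ?(IHq v w) //.
    by move=> l lq; apply: H; rewrite mem_cat lq orbT.
  by move=> l lp; apply: H; rewrite mem_cat lp.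
Qed.

(** A sentence that fails in [N] has its negation in [Th N]. *)
Lemma Th_complete (L : Type) (M N : structure L) :
  models M (Th N) ->
  forall phi : formula L void, sat (of_void M) phi <-> sat (of_void N) phi.
Proof.
move=> MN phi; split; last exact: MN.
apply: contraPP => nphi; exact: (MN (Imp phi (@Bot L void))).
Qed.

(** * Definable preorders on the Urysohn space *)

Lemma exists_extremum (T : eqType) (e : rel T) (s : seq T) (P : T -> Prop) :
  total e -> transitive e -> (exists2 x, x \in s & P x) ->
  exists x, [/\ x \in s, P x & forall y, y \in s -> P y -> e x y].
Proof.
move=> te tr; elim: s => [[]//|z s IHs] [x xs Px].
have [[y ys Py]|nPs] := pselect (exists2 y, y \in s & P y); last first.
  move: xs; rewrite inE => /predU1P[xz|xs]; last by case: nPs; exists x.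
  exists z; rewrite mem_head -xz; split=> // w; rewrite inE => /predU1P[->|ws Pw].
    by have := te x x; rewrite orbb.
  by case: nPs; exists w.
have [|m [ms Pm mM]] := IHs; first by exists y.
have [[Pz zm]|nz] := pselect (P z /\ e z m).
  exists z; rewrite mem_head; split=> // w; rewrite inE => /predU1P[->|ws Pw].
    by have := te z z; rewrite orbb.
  by apply: tr zm (mM _ ws Pw).
exists m; rewrite inE ms orbT; split=> // w; rewrite inE => /predU1P[->|ws Pw].
  by move=> Pz; have /orP[//|zm] := te m z; case: nz.
exact: mM.
Qed.

Section Urysohn.
Variables (d : Order.disp_t) (R : distMonoid d).
Implicit Types r s t : R.

Lemma le_addl s r : r <= s ⊕ r.
Proof. by rewrite -{1}(dm_add0 r); apply/dm_leD2r/dm_ge0. Qed.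

Lemma le_addr s r : r <= r ⊕ s.
Proof. by rewrite dm_addC le_addl. Qed.

Lemma le_zero r : r <= dm_zero <-> r = dm_zero.
Proof.
by split=> [r0|->//]; apply/eqP; rewrite eq_le r0 dm_ge0.
Qed.

Section Triangle.
Variables (r t : R).
Hypotheses (r0 : r <> dm_zero) (t0 : t <> dm_zero) (trr : t <= r ⊕ r).

(** The apex is [None], the two legs have length [r] and the base length [t]. *)
Definition isosceles_dist (x y : option bool) : R :=
  match x, y with
  | None, None => dm_zero
  | Some b, Some c => if b == c then dm_zero else t
  | _, _ => r
  end.

Lemma isosceles_sym x y : isosceles_dist x y = isosceles_dist y x.
Proof. by move: x y => [[]|] [[]|]. Qed.

Lemma isosceles_eq0 x y : isosceles_dist x y = dm_zero <-> x = y.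
Proof. by move: x y => [[]|] [[]|]; split=> //= H; case: r0; case: t0. Qed.

Lemma isosceles_triangle x y z :
  isosceles_dist x z <= isosceles_dist x y ⊕ isosceles_dist y z.
Proof.
by move: x y z => [[]|] [[]|] [[]|] //=;
  rewrite ?(dm_addC _ dm_zero) ?dm_add0 ?dm_ge0 ?le_addl ?le_addr.
Qed.

Definition isosceles : metricSpace R :=
  MetricSpace isosceles_sym isosceles_eq0 isosceles_triangle.

End Triangle.

Variable U : metricSpace R.
Hypothesis hU : urysohn_space U.

Lemma urysohn_isosceles r t : r <> dm_zero -> t <> dm_zero -> t <= r ⊕ r ->
  exists x y z : U, [/\ dist x y = r, dist y z = r & dist x z = t].
Proof.
move=> r0 t0 trr; case: hU => _ _ /(_ (isosceles r0 t0 trr)) [|f Hf].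
  exact: (@finite_finset (option bool)).
by exists (f (Some true)), (f None), (f (Some false)); rewrite !Hf.
Qed.

Lemma urysohn_dist r : r <> dm_zero -> exists x y : U, dist x y = r.
Proof.
move=> r0; have [x [y [_ [xy _ _]]]] := urysohn_isosceles r0 r0 (le_addl r r).
by exists x, y.
Qed.

(** By isosceles triangles, the distances at which [G] holds form an initial
    segment of [R] closed under [⊕]. As [G] cannot separate two distances that
    compare in the same way with all elements of [l], this segment, if proper,
    has a greatest element, which belongs to [l] (or is zero) and is
    idempotent. *)
Lemma preorder_ball (G : U -> U -> Prop) (l : seq R) :
  preorder G ->
  (forall x y x' y', (x = y <-> x' = y') ->
     (forall r, r \in l -> dist x y <= r <-> dist x' y' <= r) ->
     G x y -> G x' y') ->
  (forall x y, G x y) \/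
  exists2 m : R, m ⊕ m = m & forall x y, G x y <-> dist x y <= m.
Proof.
move=> [Gr Gt] Gl.
have eq_dist x y x' y' : dist x y = dist x' y' -> (x = y <-> x' = y').
  by move=> E; rewrite -!dist_eq0 E.
have dd (x : U) : dist x x = dm_zero by apply/dist_eq0.
have Gdouble x y x' y' : G x y -> dist x' y' <= dist x y ⊕ dist x y -> G x' y'.
  move=> Gxy; have [/dist_eq0 ->//|t0] := pselect (dist x' y' = dm_zero).
  have [E|r0] := pselect (dist x y = dm_zero).
    by rewrite E dm_add0 => /le_zero.
  move=> /(urysohn_isosceles r0 t0)[u [v [w [uv vw uw]]]].
  apply: (Gl u w) (Gt _ v _ _ _); rewrite ?uw //; first exact: eq_dist.
    by apply: (Gl x y); rewrite ?uv //; apply: eq_dist.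
  by apply: (Gl x y); rewrite ?vw //; apply: eq_dist.
have [?|] := pselect (forall x y, G x y); first by left.
rewrite -existsNP => -[x0]; rewrite -existsNP => -[y0 nG0]; right.
(* Comparing distances with zero takes care of the equality symbol. *)
pose l0 := dm_zero :: l.
have Gl0 x y x' y' : G x y ->
    (forall r, r \in l0 -> dist x y <= r <-> dist x' y' <= r) -> G x' y'.
  move=> Gxy H; apply: Gl Gxy => [|r rl]; last by apply: H; rewrite inE rl orbT.
  by rewrite -!dist_eq0 -!le_zero; apply: H; rewrite mem_head.
pose I r := exists x y, G x y /\ dist x y = r.
have G0 : I dm_zero by exists x0, x0.
have bound x y : G x y -> exists2 r, r \in l0 & dist x y <= r /\ I r.
  move=> Gxy.
  (* The least element of [l0] above d(x, y) is not separated from d(x, y). If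
     there were none, the larger distance d(x0, y0) would not be separated from
     d(x, y) either. *)
  have [|r [rl xyr rmin]] :=
      @exists_extremum R <=%O l0 (fun r => dist x y <= r) le_total le_trans.
    apply: contrapT => nr; apply: (nG0); apply: Gl0 (Gxy) _ => r rl.
    split=> [xyr|H]; first by case: nr; exists r.
    case: nr; exists r => //; apply: le_trans H.
    have /orP[//|le0] := le_total (dist x y) (dist x0 y0).
    by case: nG0; apply: Gdouble Gxy (le_trans le0 (le_addl _ _)).
  exists r => //; split=> //.
  have [r0|r0] := pselect (r = dm_zero).
    by exists x, x; split=> //; rewrite r0.
  have [u [v uv]] := urysohn_dist r0; exists u, v; split=> //.
  apply: Gl0 Gxy _ => t tl; rewrite uv; split; last exact: le_trans.
  exact: rmin.
have [|m [ml [u [v [Guv uvm]]] mM]] :=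
    @exists_extremum R >=%O l0 I ge_total ge_trans.
  by exists dm_zero; rewrite ?mem_head.
have le_m x y : G x y -> dist x y <= m.
  by move=> /bound[r rl [xyr /(mM _ rl)]]; apply: le_trans.
exists m => [|x y]; last first.
  split=> [|xym]; first exact: le_m.
  by apply: Gdouble Guv _; rewrite uvm; apply: le_trans xym (le_addl _ _).
apply/eqP; rewrite eq_le le_addl andbT.
have [->|m0] := pselect (m ⊕ m = dm_zero); first exact: dm_ge0.
have [x [y xy]] := urysohn_dist m0.
by rewrite -xy; apply/le_m/(Gdouble _ _ _ _ Guv); rewrite uvm xy.
Qed.

End Urysohn.

(** * Models of the theory of the Urysohn space *)

Section Models.
Variables (d : Order.disp_t) (R : distMonoid d).
Hypothesis hR : urysohn_monoid R.
Variable U : metricSpace R.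
Hypothesis hU : urysohn_space U.
Variable M : structure R.
Hypothesis hM : models M (Th (metric_structure U)).

Lemma model_refl r (x : M) : interp r x x.
Proof.
have H : Th (metric_structure U) (All (Rel r None None)).
  by move=> y /=; have /dist_eq0 -> := erefl y; apply: dm_ge0.
exact: (hM H).
Qed.

Lemma model_sym r (x y : M) : interp r x y -> interp r y x.
Proof.
have H : Th (metric_structure U)
    (All (All (Imp (Rel r (Some None) None) (Rel r None (Some None))))).
  by move=> u v /=; rewrite dist_sym.
exact: (hM H).
Qed.

Lemma model_triangle r s t (x y z : M) : r ⊕ s <= t ->
  interp r x y -> interp s y z -> interp t x z.
Proof.
move=> rst; have H : Th (metric_structure U)
    (All (All (All (Imp (Rel r (Some (Some None)) (Some None))
                   (Imp (Rel s (Some None) None) (Rel t (Some (Some None)) None)))))).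
  move=> u v w /= uv vw; apply: le_trans (dist_triangle u v w) (le_trans _ rst).
  by apply: le_trans (dm_leD2r _ uv) _; rewrite !(dm_addC r); apply: dm_leD2r.
exact: (hM H).
Qed.

Lemma model_max r (x y : M) : is_max r -> interp r x y.
Proof.
move=> mr; have H : Th (metric_structure U) (All (All (Rel r (Some None) None))).
  by move=> u v /=; apply: mr.
exact: (hM H).
Qed.

Lemma model_qe (n : nat) (phi : formula R 'I_n) :
  exists psi : formula R 'I_n, quantifier_free psi /\
    forall N : structure R, models N (Th (metric_structure U)) ->
      forall v : 'I_n -> N, sat v phi <-> sat v psi.
Proof. by case: hR => _ /(_ U hU n phi). Qed.

(** A quantifier-free formula in one variable only speaks of d(x, x). *)
Lemma model_one_type (x y : M) (phi : formula R unit) :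
  sat (fun=> x) phi <-> sat (fun=> y) phi.
Proof.
have [psi [qf H]] := model_qe (rename (fun=> ord0 : 'I_1) phi).
have E z : sat (fun=> z : M) phi <-> sat (fun=> z : M) psi.
  by rewrite -H // sat_rename.
rewrite !E; apply: sat_agree => // l _ i j.
by split=> _; apply: model_refl.
Qed.

Lemma model_ex_between s t : s < t ->
  exists x y : M, interp t x y /\ ~ interp s x y.
Proof.
move=> st; have t0 : t <> dm_zero.
  by move=> t0; move: st; rewrite t0 ltNge dm_ge0.
have [u [v uv]] := urysohn_dist hU t0.
pose phi : formula R void := All (All (Imp (Rel t (Some None) None)
                                           (Rel s (Some None) None))).
apply: contrapT => nM.
have : sat (of_void M) phi.
  move=> x y /= txy; apply: contrapT => nxy; apply: nM; exists x, y; split=> //.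
move/(Th_complete hM)/(_ u v) => /=; rewrite uv => /(_ (lexx _)).
by rewrite leNgt st.
Qed.

(** Both being a preorder and being a ball relation are expressed by sentences,
    once the definable relation has a quantifier-free definition that is valid
    in all models. *)
Lemma model_preorder_ball (F : M -> M -> Prop) :
  preorder F ->
  definable (fun v : 'I_2 -> M => F (v ord0) (v (lift ord0 ord0))) ->
  (forall x y, F x y) \/
  exists2 m : R, m ⊕ m = m & forall x y, F x y <-> interp m x y.
Proof.
move=> [Fr Ft] [phi Hphi]; have [chi [qf Hchi]] := model_qe phi.
have FE x y : F x y <-> sat (pair_fun x y) chi by rewrite -Hchi // Hphi.
pose ren (V : Type) (i j : V) := rename (pair_fun i j) chi.
have renE (N : structure R) (V : Type) (v : V -> N) i j :
    sat v (ren V i j) <-> sat (pair_fun (v i) (v j)) chi.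
  rewrite sat_rename; suff -> : v \o pair_fun i j = pair_fun (v i) (v j) by [].
  by apply/funext => k; rewrite /pair_fun /=; case: ifP.
pose G (x y : U) := sat (M := metric_structure U) (pair_fun x y) chi.
have GP : preorder G.
  split.
    have : sat (of_void M) (All (ren _ None None)).
      by move=> x; apply/renE/FE; apply: Fr.
    by move/(Th_complete hM) => H x; exact: (iffLR (renE _ _ _ _ _) (H x)).
  have : sat (of_void M)
      (All (All (All (Imp (ren _ (Some (Some None)) (Some None))
        (Imp (ren _ (Some None) None) (ren _ (Some (Some None)) None)))))).
    by move=> x y z /renE/FE xy /renE/FE yz; apply/renE/FE; apply: Ft yz.
  move/(Th_complete hM) => H x y z xy yz.
  by apply: (iffLR (renE _ _ _ _ _) (H x y z (iffRL (renE _ _ _ _ _) xy)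
    (iffRL (renE _ _ _ _ _) yz))).
have [|Gall|[m mm Gm]] := preorder_ball hU (G := G) (l := symbols chi) GP.
- move=> x y x' y' E H; apply: iffLR; apply: sat_agree => //.
  + have E' : y = x <-> y' = x' by split=> /esym/E.
    by move=> i j; rewrite /pair_fun; do 2!case: ifP.
  + move=> l lchi i j; rewrite /pair_fun /=.
    have dd (z : U) : dist z z <= l by have /dist_eq0 -> := erefl z; apply: dm_ge0.
    by do 2!case: ifP => _; rewrite ?dd ?(H _ lchi) // dist_sym (dist_sym y') H.
- left=> x y; have : sat (of_void (metric_structure U))
      (All (All (ren _ (Some None) None))).
    by move=> u v; apply/renE; apply: Gall.
  by move/(Th_complete hM)/(_ x y)/renE/FE.
- right; exists m => // x y.
  have : sat (of_void (metric_structure U))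
      (All (All (Imp (ren _ (Some None) None) (Rel m (Some None) None)))).
    by move=> u v /renE /= /Gm.
  move/(Th_complete hM)/(_ x y) => /= H1.
  have : sat (of_void (metric_structure U))
      (All (All (Imp (Rel m (Some None) None) (ren _ (Some None) None)))).
    by move=> u v /= uv; apply/renE; apply/Gm.
  move/(Th_complete hM)/(_ x y) => /= H2.
  split; first by move/FE => Fxy; apply/H1/renE.
  by move/H2/renE/FE.
Qed.

Variable kappa : Type.
Hypotheses (hN : small kappa [set: nat]) (hsat : saturated kappa M).
Hypothesis hhom : strongly_homogeneous kappa M.

Lemma small_unit : small kappa [set: unit].
Proof. exact: small_countable. Qed.

Lemma model_transitive (x y : M) : exists s : M -> M, automorphism s /\ s x = y.
Proof.
have [s [As sx]] := hhom small_unit (model_one_type x y).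
by exists s; split=> //; apply: (sx tt).
Qed.

(** The conditions d(a, x) <= r, not d(a, x) <= s for [r] in [S] form a chain,
    each of which has a solution. The element [r1] only serves to have at least
    one condition when [S] is empty. *)
Lemma model_realize_gap (S : set R) s r1 (a : M) :
  s < r1 -> (forall r, S r -> s < r) ->
  exists b : M, (forall r, S r -> interp r a b) /\ ~ interp s a b.
Proof.
move=> sr1 sS.
pose X (j : {r : R | S r \/ r = r1}) (v : option unit -> M) :=
  interp (sval j) (v (Some tt)) (v None) /\ ~ interp s (v (Some tt)) (v None).
have lt_s (j : {r : R | S r \/ r = r1}) : s < sval j.
  by case: j => r /= [/sS|->].
have dX j : definable (X j).
  apply: definable_and; first by exists (Rel (sval j) (Some tt) None).
  by apply: definable_not; exists (Rel s (Some tt) None).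
have [||b Xb] := saturated_directed hN hsat (a := fun=> a)
    (exist _ r1 (or_intror erefl)) dX.
- have mono (i j : {r : R | S r \/ r = r1}) v :
      sval i <= sval j -> X i v -> interp (sval j) (v (Some tt)) (v None).
    move=> ij [iv _]; apply: model_triangle iv (model_refl dm_zero _).
    by rewrite dm_addC dm_add0.
  move=> i j; have /orP[ij|ji] := le_total (sval i) (sval j).
    by exists i => v Xv; split=> //; split; [apply: mono Xv|case: Xv].
  by exists j => v Xv; split=> //; split; [apply: mono Xv|case: Xv].
- move=> j; have [x [y [xy nxy]]] := model_ex_between (lt_s j).
  have [sg [[bs As] <-]] := model_transitive x a.
  by exists (sg y); split; rewrite /= As.
- exists b; split=> [r Sr|]; last by case: (Xb (exist _ r1 (or_intror erefl))).
  by case: (Xb (exist _ r (or_introl Sr))).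
Qed.

End Models.

(** * Idempotent cuts *)

Section Cuts.
Variables (d : Order.disp_t) (R : distMonoid d).

Lemma star_ext (a b : star R) : cut a = cut b -> a = b.
Proof.
case: a b => A uA nA [B uB nB] /= AB; subst B.
by congr Star; apply: Prop_irrelevance.
Qed.

(** This is the triangle inequality for the relation d(x, y) <= alpha. For a
    maximal [r] the condition d(x, y) <= r is automatic. *)
Lemma idempotent_cut_split (alpha : star R) r :
  idempotents (@star_add d R) alpha -> cut alpha r ->
  is_max r \/ exists r1 r2, [/\ cut alpha r1, cut alpha r2 & r1 ⊕ r2 <= r].
Proof.
move=> idem; rewrite -{1}idem => -[[c [r1 [r2 [a1 a2 ->]]] /= cr]|]; last by left.
by right; exists r1, r2; split=> //; [apply: a1|apply: a2] => /=.
Qed.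

Lemma heq_gap (alpha : star R) : heq R alpha ->
  exists s, [/\ cut alpha s, ~ is_max s &
    forall r, r ⊕ r = r -> cut alpha r -> s < r].
Proof.
move=> [_ [le_ab ne_ab]]; apply: contrapT => nS; apply: ne_ab; apply: star_ext.
apply/seteqP; split=> // s a_s; apply: contrapT => nbs; apply: nS; exists s.
split=> // [ms|r rr ar]; first by apply: nbs; right.
rewrite ltNge; apply/negP => rs; apply: nbs; left; exists (star_embed r) => //.
by exists r => //; split=> // x /= rx; apply: cut_up rx.
Qed.

End Cuts.

(** * Failure of elimination of hyperimaginaries *)

Theorem theorem7p13 (d : Order.disp_t) (R : distMonoid d) (hR : urysohn_monoid R)
    (hnontriv : exists r : R, r <> dm_zero)
    (U : metricSpace R) (hU : urysohn_space U)
    (kappa : Type) (M : structure R)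
    (hM : monster_model kappa (Th (metric_structure U)) M)
    (hheq : heq R !=set0) :
  ~ eliminates_hyperimaginaries kappa M.
Proof.
case: hM => hmod [hN _] hsat hhom; case: hheq => alpha halpha elim_h.
have [s [a_s nmax_s gap]] := heq_gap halpha; case: halpha => idem _.
have [r1 sr1] : exists r1, s < r1.
  apply: contrapT => nr1; apply: nmax_s => x; rewrite leNgt; apply/negP => sx.
  by apply: nr1; exists x.
have [a _] := model_ex_between hU hmod sr1.
pose p : set (formula R (unit + unit)) :=
  [set Rel r (inl tt) (inr tt) | r in cut alpha].
have pE (x y : unit -> M) : type_rel p x y <->
    forall r, cut alpha r -> interp r (x tt) (y tt).
  split=> [H r ar|H _ [r ar <-]]; last exact: H.
  by have := H (Rel r (inl tt) (inr tt)); apply; exists r.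
have pequiv : RelationClasses.Equivalence (type_rel (M := M) p).
  split=> [x|x y|x y z].
  - by apply/pE => r _; apply: model_refl hmod _ _.
  - by move=> /pE H; apply/pE => r /H; apply: model_sym hmod _ _ _.
  - move=> /pE xy /pE yz; apply/pE => r ar.
    have [mr|[r2 [r3 [a2 a3 le_r]]]] := idempotent_cut_split idem ar.
      exact: model_max hmod _ _ _ mr.
    exact: (model_triangle hmod le_r (xy _ a2) (yz _ a3)).
pose e : set (unit -> M) := [set b | type_rel p (fun=> a) b].
have fixe sg : automorphism sg ->
    fixes sg e <-> forall r, cut alpha r -> interp r a (sg a).
  by move=> As; rewrite fixesP // pE.
have htrans := model_transitive hR hU hmod hN hhom.
have [A [_ HA]] := elim_h unit p e (small_unit hN) pequiv
  (ex_intro _ (fun=> a) erefl).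
have [b [ab nab]] := model_realize_gap hR hU hmod hN hsat hhom
  (S := [set r | r ⊕ r = r /\ cut alpha r]) a sr1
  (fun r Sr => gap r Sr.1 Sr.2).
have [sg [As sgab]] := htrans a b.
apply: nab; rewrite -sgab; apply: (iffLR (fixe _ As)) (a_s).
apply/HA => // c Ac.
have fixc t : automorphism t -> (forall r, cut alpha r -> interp r a (t a)) ->
    fixes t (im_class c).
  by move=> At /(fixe _ At)/(HA _ At); apply.
(* [F] holds between [a] and its images exactly when [c] is fixed, so
   it remains to see that [F a b]. *)
have [|F [Fpre Fdef Ffix]] :=
    definable_preorder_of_imaginary hN hsat hhom htrans (a := a) (c := c).
  by move=> t At ta; apply: fixc => // r _; rewrite ta; apply: model_refl hmod _ _.
apply/Ffix => //; rewrite sgab.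
have [//|[m mm FE]] := model_preorder_ball hR hU hmod Fpre Fdef.
(* If [alpha <= m] failed, a point within [alpha] of [a] but not within [m]
   would be the image of [a] under an automorphism fixing [e] and not [c]. *)
apply/FE/ab; split=> //; apply: contrapT => nam.
have [||b' [ab' nab']] := model_realize_gap hR hU hmod hN hsat hhom
    (S := cut alpha) (s := m) (r1 := s) a.
- rewrite ltNge; apply/negP => sm; apply: nam; exact: cut_up a_s sm.
- move=> r ar; rewrite ltNge; apply/negP => rm; apply: nam; exact: cut_up ar rm.
have [t [At tab]] := htrans a b'.
by apply: nab'; apply/FE; rewrite -tab; apply/Ffix/fixc => //; rewrite tab.
Qed.
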